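(* Assume that $(A,\mathcal{D}(A))$ is a densely defined self-adjoint infinitesimal generator on $L^2(S,\pi)$ of a strongly continuous semigroup for an ergodic invariant probability $\pi$ such that $A^{-1}$ is a bounded linear operator on $\mathcal{R}(A)=1_\pi^\perp$ and, moreover, that $A^{-1}$ is an infinitesimal generator on $\mathcal{D}(A^{-1})\subset1_\pi^\perp$ of a Markov process on $S$. Then the Gaussian random field $\{B(f,1):f\in1_\pi^\perp\}$ is associated with a Markov process $Y$ on $S$ via the specification of its covariance by the Dirichlet form of $Y$; that is, there is a Markov process $Y$ on $S$ whose Dirichlet form is $\mathcal{E}(f,g)=-2\langle f,A^{-1}g\rangle_\pi$, $f,g\in 1_\pi^\perp$, and $$\mathbb{E}\,B(f,1)B(g,1)=\mathcal{E}(f,g),\qquad f,g\in1_\pi^\perp .$$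
   Context: Setting: $X=\{X(t):t\ge0\}$ is a progressively measurable Markov process on a measurable state space $(S,\mathcal{S})$, defined on a complete probability space, with initial distribution the ergodic invariant probability $\pi$, and $A$ is the infinitesimal generator of its transition semigroup on the real Hilbert space $L^2(S,\pi)$ with inner product $\langle\cdot,\cdot\rangle_\pi$. $1_\pi^\perp=\{f\in L^2(S,\pi):\int_S f\,d\pi=0\}$. $A^{-1}$ is the generalized inverse of $A$: the inverse of the bijection $A:\mathcal{D}(A)\cap 1_\pi^\perp\to1_\pi^\perp$, vanishing on $\mathcal{R}(A)^\perp$ (the constants). Brownian field: $\{B(f,t):f\in1_\pi^\perp,t\ge0\}$ is the space-time generalized Brownian motion (Brownian UGRF) with spatial covariance operator $-2A^{-1}$: a centered jointly Gaussian field, linear in $f$ (a.s.), such that for all $f_1,\dots,f_m\in 1_\pi^\perp$ the process $t\mapsto(B(f_1,t),\dots,B(f_m,t))$ is an $m$-dimensional Brownian motion and $\mathbb{E}B(f,s)B(g,t)=(s\wedge t)(-2\langle f,A^{-1}g\rangle_\pi)$. It is the limit in distribution of $n^{-1/2}\int_0^{nt}f(X_s)\,ds$. The Dirichlet form of a Markov process with (self-adjoint) generator $L$ on $1_\pi^\perp\subset L^2(S,\pi)$ is $\mathcal{E}(f,g)=-\langle f,Lg\rangle_\pi$. A Gaussian random field indexed by functions is associated with a Markov process via its Dirichlet form (Diaconis–Evans) if its covariance is this Dirichlet form. *)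

(* Defs.v *)
From HB Require Import structures.
From mathcomp Require Import all_boot all_order all_algebra.
From mathcomp Require Import all_classical all_reals all_analysis.
From mathcomp Require Import measurable_realfun.

Set Implicit Arguments.
Unset Strict Implicit.
Unset Printing Implicit Defensive.

Import Order.TTheory GRing.Theory Num.Theory.
Import numFieldNormedType.Exports.

Local Open Scope classical_set_scope.
Local Open Scope ring_scope.

(** * The Hilbert space L^2(S, pi)

    Elements are classes modulo almost everywhere equality, so Leibniz equality
    on [L2 pi] is equality in L^2.  The library puts no vector space structure
    on this type: linear combinations are written on representatives, up to
    almost everywhere equality. *)

Definition L2 d (S : measurableType d) (R : realType) (pi : probability S R) :
  Type := LspaceType2 pi.

Section L2.
Context d (S : measurableType d) (R : realType) (pi : probability S R).

Definition L2_fun (f : L2 pi) : S -> R := aqEqMfun_to_fun (LebesgueSpace.sort f).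

HB.instance Definition _ := gen_eqMixin (L2 pi).
HB.instance Definition _ := gen_choiceMixin (L2 pi).

(* The library's classes take values in [measurableTypeR R], which has the Borel
   sets of [R] under another display. *)
Lemma Borel_measurable_fun (f : {mfun S >-> R}) :
  measurable_fun [set: S] (f : S -> measurableTypeR R).
Proof. by move=> mD Y mY; exact: (@measurable_funP _ _ _ _ _ f). Qed.

Definition Borel_mfun (f : {mfun S >-> R}) : {mfun S >-> measurableTypeR R} :=
  MeasurableFun.Pack (MeasurableFun.Class
    (isMeasurableFun.Build _ _ _ _ (f : S -> measurableTypeR R)
       (Borel_measurable_fun f))).

Definition ae_class (f : {mfun S >-> R}) : {mfun_ pi, S >-> measurableTypeR R} :=
  \pi%qT (Borel_mfun f).

Lemma ae_classE (f : {mfun S >-> R}) : (ae_class f : S -> R) = f %[ae pi].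
Proof.
suff : ae_eq_op pi (repr (ae_class f)) (Borel_mfun f) by move=> /asboolP.
by rewrite -eqmodE reprK.
Qed.

Lemma ae_class_finite (f : LfunType pi (lee1n 2)) :
  finite_norm pi 2%:R%:E (ae_class f).
Proof.
rewrite /finite_norm.
suff -> : 'N[pi]_2%:R%:E[EFin \o ae_class f]%E = 'N[pi]_2%:R%:E[EFin \o f]%E.
  exact: Lfunction_finite.
rewrite unlock /Lnorm; congr (_ `^ _)%E.
have mae : measurable_fun [set: S] (ae_class f : S -> R).
  by move=> mD Y mY; exact: (@measurable_funP _ _ _ _ _ (repr (ae_class f))).
apply: ae_eq_integral => //.
- apply: (@measurableT_comp _ _ _ _ _ _ (@poweR R ^~ 2)).
    exact: measurable_poweR.
  by apply: measurableT_comp => //; exact/measurable_EFinP.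
- apply: (@measurableT_comp _ _ _ _ _ _ (@poweR R ^~ 2)).
    exact: measurable_poweR.
  by apply: measurableT_comp => //; exact/measurable_EFinP.
by apply: filterS (ae_classE f) => x gf xT /=; rewrite gf.
Qed.

Definition L2_class (f : LfunType pi (lee1n 2)) : L2 pi :=
  LebesgueSpace.Pack (LebesgueSpace.Class
    (isFinLebesgue.Build _ _ _ _ _ (lee1n 2) _ (ae_class_finite f))).

Lemma L2_classE (f : LfunType pi (lee1n 2)) : L2_fun (L2_class f) = f %[ae pi].
Proof. exact: ae_classE. Qed.

Lemma L2P (f g : L2 pi) : f = g <-> L2_fun f = L2_fun g %[ae pi].
Proof.
split=> [->|fg]; first exact: (aeW pi).
case: f g fg => [f [[fF]]] [g [[gF]]] fg.
have e : f = g.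
  by rewrite -[f]reprK -[g]reprK; apply/eqmodP/asboolP.
by subst g; congr (LebesgueSpace.Pack (LebesgueSpace.Class _)); congr isFinLebesgue.Axioms_; exact: Prop_irrelevance.
Qed.

End L2.

Coercion L2_fun : L2 >-> Funclass.

Section hilbert.
Context d (S : measurableType d) (R : realType) (pi : probability S R).
Implicit Types (f g h : L2 pi) (H D : set (L2 pi)) (A : L2 pi -> L2 pi).

Definition dot f g : R := \int[pi]_x (f x * g x).

(* Defined on functions, so that it applies to expressions in representatives. *)
Definition norm2 (u : S -> R) : \bar R := 'N[pi]_2%:R%:E[EFin \o u]%E.

Definition mean0 : set (L2 pi) := [set f | \int[pi]_x f x = 0].

Definition dense_in H D :=
  D `<=` H /\
  forall f (e : R), H f -> 0 < e ->
    exists2 g, D g & (norm2 (fun x => (f x - g x)%R) < e%:E)%E.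

(** An operator with domain [D] is a total function [A] whose values outside
    [D] are irrelevant.  [H] is a closed subspace, itself viewed as a Hilbert
    space. *)

Definition self_adjoint H D A :=
  [/\ dense_in H D, A @` D `<=` H &
    forall g h, H g -> H h ->
      ((forall f, D f -> dot (A f) g = dot f h) <-> D g /\ A g = h)].

Definition bounded_linear_on H A :=
  (forall (a : R) f g h, H f -> H g -> H h ->
    h = (fun x => a * f x + g x) %[ae pi] ->
    A h = (fun x => a * A f x + A g x) %[ae pi]) /\
  exists C : R, forall f, H f -> (norm2 (A f) <= C%:E * norm2 f)%E.

(** The value at [h = A f + k], for [f] in the domain with mean zero and [k]
    orthogonal to the range, is [f]; outside R(A) + R(A)^perp the value is
    [L2_class 0]. *)
Definition generalized_inverse D A h : L2 pi :=
  xget (L2_class (0 : LfunType pi (lee1n 2)))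
    [set f | [/\ D f, mean0 f &
      exists k, (forall g, D g -> dot (A g) k = 0) /\
                h = (fun x => A f x + k x) %[ae pi]]].

Definition dirichlet_form A f g : R := - dot f (A g).

End hilbert.

Arguments mean0 {d S R} pi.

Section markov.
Context d (S : measurableType d) (R : realType).
Implicit Types (pi : probability S R) (K : R -> R.-pker S ~> S).

(** Time is the half-line [0 <= t] of [R]; every family indexed by time is
    constrained only there. *)

Definition transition_semigroup K :=
  (forall x B, measurable B -> K 0 x B = \d_x B) /\
  forall (s t : R) x B, 0 <= s -> 0 <= t -> measurable B ->
    K (s + t) x B = (\int[K s x]_y K t y B)%E.

Definition invariant_prob pi K :=
  forall (t : R) B, 0 <= t -> measurable B -> (\int[pi]_x K t x B)%E = pi B.

Definition ergodic pi K :=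
  forall B, measurable B ->
    (forall t : R, 0 <= t -> {ae pi, forall x, K t x B = \d_x B}) ->
    pi B = 0%E \/ pi B = 1%E.

Definition semigroup K (t : R) (u : S -> R) (x : S) : R := \int[K t x]_y u y.

Definition strongly_continuous pi K (H : set (L2 pi)) :=
  forall f, H f ->
    norm2 pi (fun x => semigroup K t f x - f x) @[t --> 0^'+] --> 0%E.

(* [g] is the derivative at [0+] of [t |-> semigroup K t f] in L^2. *)
Definition derivative0 pi K (f g : L2 pi) :=
  norm2 pi (fun x => t^-1 * (semigroup K t f x - f x) - g x)
    @[t --> 0^'+] --> 0%E.

(** [(A, D)] is the infinitesimal generator on [H] of the strongly continuous
    semigroup given by the transition kernels [K]. *)
Definition generator pi K (H D : set (L2 pi)) (A : L2 pi -> L2 pi) :=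
  [/\ strongly_continuous K H,
      D = [set f | H f /\ exists2 g, H g & derivative0 K f g] &
      forall f, D f -> H (A f) /\ derivative0 K f (A f)].

Section process.
Context dW (W : measurableType dW) (P : probability W R).
Implicit Types (F : R -> set (set W)) (X : R -> W -> S).

Definition filtration F :=
  (forall t : R, 0 <= t -> sigma_algebra [set: W] (F t) /\ F t `<=` measurable) /\
  forall s t : R, 0 <= s -> s <= t -> F s `<=` F t.

Definition adapted F X :=
  forall (t : R) B, 0 <= t -> measurable B -> F t (X t @^-1` B).

(* The sigma-algebra is that generated on [R * W] by the rectangles [U x V],
   with [U] Borel and [V] in [F t]; its trace on [0, t] x W is the usual one. *)
Definition progressively_measurable F X :=
  forall (t : R) B, 0 <= t -> measurable B ->
    <<s [set C | exists U V, [/\ measurable U, F t V & C = U `*` V]] >>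
      [set p : R * W | 0 <= p.1 <= t /\ B (X p.1 p.2)].

(** Markov process with transition kernels [K], with respect to the filtration
    [F], started from its invariant probability [pi]. *)
Definition markov_process F pi K X :=
  [/\ filtration F, adapted F X, transition_semigroup K &
      [/\ invariant_prob pi K,
          forall B, measurable B -> P (X 0 @^-1` B) = pi B &
          forall (s t : R) B C, 0 <= s -> s <= t -> measurable B -> F s C ->
            P (C `&` X t @^-1` B) = (\int[P]_(w in C) K (t - s)%R (X s w) B)%E]].

End process.

(** [E], on [D], is the Dirichlet form of the Markov process with transition
    kernels [K], seen on the mean zero functions. *)
Definition is_dirichlet_form pi K (D : set (L2 pi)) (E : L2 pi -> L2 pi -> R) :=
  exists A, [/\ generator K (mean0 pi) D A, self_adjoint (mean0 pi) D A &
    forall f g, D f -> D g -> E f g = dirichlet_form A f g].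

End markov.

Section gaussian.
Context dW (W : measurableType dW) (R : realType) (Q : probability W R).

(* [normal_prob 0 0] is not the point mass, which is therefore treated apart. *)
Definition centered_normal (Y : W -> R) (v : R) :=
  0 <= v /\
  forall A : set R, measurable A ->
    Q (Y @^-1` A) = if v == 0 then \d_(0 : R) A else normal_prob 0 (Num.sqrt v) A.

(* Joint Gaussianity: all finite linear combinations are Gaussian. *)
Definition centered_gaussian_field (I : Type) (J : set I) (G : I -> {RV Q >-> R}) :=
  forall n (c : 'I_n -> R) (i : 'I_n -> I), (forall k, J (i k)) ->
    exists v : R, centered_normal (fun w => \sum_(k < n) c k * G (i k) w) v.

(** Brownian motion in R^m with covariance matrix [V].  The joint laws on
    rectangles determine independence of the vectors of increments. *)
Definition brownian_motion m (V : 'M[R]_m) (Z : 'I_m -> R -> {RV Q >-> R}) :=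
  [/\ {ae Q, forall w i, Z i 0 w = 0},
      {ae Q, forall w i, {within [set t | 0 <= t], continuous (fun t => Z i t w)}},
      forall n (u : nat -> R) (E : 'I_n -> 'I_m -> set R),
        0 <= u 0%N -> (forall k, u k <= u k.+1) -> (forall k i, measurable (E k i)) ->
        Q [set w | forall (k : 'I_n) i, E k i (Z i (u k.+1) w - Z i (u k) w)] =
        (\prod_(k < n) Q [set w | forall i, E k i (Z i (u k.+1) w - Z i (u k) w)%R])%E &
      forall (s t : R) (c : 'I_m -> R), 0 <= s -> s <= t ->
        centered_normal (fun w => \sum_(i < m) c i * (Z i t w - Z i s w))
          ((t - s) * \sum_(i < m) \sum_(j < m) c i * c j * V i j)].

End gaussian.

Section fields.
Context d (S : measurableType d) (R : realType) (pi : probability S R).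
Context dW (W : measurableType dW) (Q : probability W R).

(** Space-time Brownian field indexed by the mean zero functions, with spatial
    covariance [V]. *)
Definition brownian_field (V : L2 pi -> L2 pi -> R)
    (B : L2 pi -> R -> {RV Q >-> R}) :=
  [/\ centered_gaussian_field [set p : L2 pi * R | mean0 pi p.1 /\ 0 <= p.2]
        (fun p => B p.1 p.2),
      forall (a : R) f g h (t : R), mean0 pi f -> mean0 pi g -> mean0 pi h -> 0 <= t ->
        h = (fun x => a * f x + g x) %[ae pi] ->
        {ae Q, forall w, B h t w = a * B f t w + B g t w},
      forall m (f : 'I_m -> L2 pi), (forall i, mean0 pi (f i)) ->
        brownian_motion (\matrix_(i, j) V (f i) (f j)) (fun i => B (f i)) &
      forall f g (s t : R), mean0 pi f -> mean0 pi g -> 0 <= s -> 0 <= t ->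
        'E_Q[fun w => (B f s w * B g t w)%R]%E = (Num.min s t * V f g)%:E].

(** Association, in the sense of Diaconis and Evans, of a field with the Markov
    process with transition kernels [K]: the covariance is the Dirichlet form. *)
Definition associated (G : L2 pi -> {RV Q >-> R}) (K : R -> R.-pker S ~> S) :=
  centered_gaussian_field (mean0 pi) G /\
  exists2 E, is_dirichlet_form K (mean0 pi) E &
    forall f g, mean0 pi f -> mean0 pi g ->
      'E_Q[fun w => (G f w * G g w)%R]%E = (E f g)%:E.

End fields.

(* Main.v *)
(** If [Z] is the Markov process generated by [A^-1], then [Y t = Z (2 t)] is
    generated by [2 A^-1], whose Dirichlet form is [-2 <f, A^-1 g>], the
    covariance of [B(., 1)].  The generator [2 A^-1] is self-adjoint on the
    mean zero functions because it is everywhere defined there and inherits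
    symmetry from [A]. *)

Require Import Defs.
From HB Require Import structures.
From mathcomp Require Import all_boot all_order all_algebra.
From mathcomp Require Import all_classical all_reals all_analysis.
From mathcomp Require Import measurable_realfun.

Set Implicit Arguments.
Unset Strict Implicit.
Unset Printing Implicit Defensive.

Import Order.TTheory GRing.Theory Num.Theory.
Local Open Scope classical_set_scope.
Local Open Scope ring_scope.

(** * Linear combinations, inner product and norm on classes of L^2 *)

Section L2_theory.
Context d (S : measurableType d) (R : realType) (pi : probability S R).
Implicit Types (f g h : L2 pi) (u v : S -> R).

Lemma ae_eq_Rintegral u v :
  measurable_fun [set: S] u -> measurable_fun [set: S] v ->
  u = v %[ae pi] -> \int[pi]_x u x = \int[pi]_x v x.
Proof.
move=> mu mv uv; rewrite /Rintegral; congr fine.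
apply: ae_eq_integral => //; [exact/measurable_EFinP|exact/measurable_EFinP|].
by apply: filterS uv => x uvx xT /=; rewrite uvx.
Qed.

Lemma L2_measurable f : measurable_fun [set: S] (f : S -> R).
Proof.
case: f => f [[ff]]; move=> mD Y mY.
by exact: (@measurable_funP _ _ _ _ _ (repr f)).
Qed.

Lemma L2_Lfun f : (f : S -> R) \in Lfun pi 2%:E.
Proof.
apply/andP; split; rewrite inE /=; first exact: L2_measurable.
by case: f => f [[ff]].
Qed.

Lemma L2_integrable f : pi.-integrable [set: S] (EFin \o (f : S -> R)).
Proof.
apply/Lfun1_integrable; apply: Lfun_subset12; last exact: L2_Lfun.
exact: fin_num_measure.
Qed.

Lemma L2_mul_integrable f g :
  pi.-integrable [set: S] (EFin \o (fun x => f x * g x)).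
Proof.
by apply/Lfun1_integrable; apply: Lfun2_mul_Lfun1; exact: L2_Lfun.
Qed.

Lemma L2_lin_subproof (a : R) f g :
  (fun x => a * f x + g x) \in Lfun pi 2%:E.
Proof.
have := @Lfun_submod_closed _ _ _ pi 2%:E (lee1n 2) => -[_ +].
by move=> /(_ a f g); apply; exact: L2_Lfun.
Qed.

(** One operation covers sums, differences ([a = -1]) and, with [L2_cst 0], multiples. The result is
    a class, so [dot] and the operators apply to it. *)
Definition L2_lin (a : R) f g : L2 pi :=
  L2_class (@Lfun_Sub _ _ _ pi 2%:E (lee1n 2) _ (L2_lin_subproof a f g)).

Lemma L2_linE a f g : L2_lin a f g = (fun x => a * f x + g x) %[ae pi].
Proof. exact: L2_classE. Qed.

Definition L2_cst (c : R) : L2 pi :=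
  L2_class (@Lfun_Sub _ _ _ pi 2%:E (lee1n 2) _ (Lfun_cst pi c 2)).

Lemma L2_cstE c : L2_cst c = (fun=> c) %[ae pi].
Proof. exact: L2_classE. Qed.

Definition L2_scale (a : R) f : L2 pi := L2_lin a f (L2_cst 0).

Lemma L2_scaleE a f : L2_scale a f = (fun x => a * f x) %[ae pi].
Proof.
apply: filterS2 (L2_linE a f (L2_cst 0)) (L2_cstE 0).
by move=> x + + xT => /(_ xT) -> /(_ xT) ->; rewrite addr0.
Qed.

Lemma dotC f g : dot f g = dot g f.
Proof. by rewrite /dot; apply: eq_Rintegral => x _; rewrite mulrC. Qed.

Lemma dot_linl a f g h : dot (L2_lin a f g) h = a * dot f h + dot g h.
Proof.
have intZ : pi.-integrable [set: S] (EFin \o (fun x => a * (f x * h x))).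
  rewrite [X in pi.-integrable _ X](_ : _ =
    (fun x => a%:E * (f x * h x)%:E)%E); last by apply/funext.
  by apply: integrableZl => //; exact: L2_mul_integrable.
rewrite /dot -RintegralZl//; last exact: L2_mul_integrable.
rewrite -RintegralD//; last exact: L2_mul_integrable.
apply: ae_eq_Rintegral.
- by apply: measurable_funM; exact: L2_measurable.
- by do 2?apply: measurable_funD; do ?apply: measurable_funM => //; exact: L2_measurable.
by apply: filterS (L2_linE a f g) => x + xT => /(_ xT) ->; rewrite mulrDl mulrA.
Qed.

Lemma dot_linr a f g h : dot h (L2_lin a f g) = a * dot h f + dot h g.
Proof. by rewrite dotC dot_linl !(dotC h). Qed.

Lemma dot_cstr f c : dot f (L2_cst c) = c * \int[pi]_x f x.
Proof.
rewrite -RintegralZl//; last exact: L2_integrable.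
apply: ae_eq_Rintegral.
- by apply: measurable_funM; exact: L2_measurable.
- by apply: measurable_funM => //; exact: L2_measurable.
by apply: filterS (L2_cstE c) => x + xT => /(_ xT) ->; rewrite mulrC.
Qed.

Lemma dot_scaler a f g : dot f (L2_scale a g) = a * dot f g.
Proof. by rewrite dot_linr dot_cstr mul0r addr0. Qed.

Lemma dot_scalel a f g : dot (L2_scale a f) g = a * dot f g.
Proof. by rewrite dotC dot_scaler dotC. Qed.

Lemma dot_cst1 f : dot f (L2_cst 1) = \int[pi]_x f x.
Proof. by rewrite dot_cstr mul1r. Qed.

Lemma mean0P f : mean0 pi f <-> dot f (L2_cst 1) = 0.
Proof. by rewrite dot_cst1. Qed.

Lemma dot_cst_cst c : dot (L2_cst c) (L2_cst 1) = c.
Proof.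
rewrite dotC dot_cstr -dot_cst1 /dot.
rewrite (@ae_eq_Rintegral _ (cst 1)).
- by rewrite Rintegral_cst// [X in fine X](probability_setT pi) !mulr1.
- by apply: measurable_funM => //; exact: L2_measurable.
- exact: measurable_cst.
by apply: filterS (L2_cstE 1) => x + xT => /(_ xT) ->; rewrite mulr1.
Qed.

Lemma dot_eq0 f : dot f f = 0 -> f = L2_cst 0.
Proof.
move=> ff; apply/L2P.
have mff : measurable_fun [set: S] (EFin \o (fun x => f x * f x)).
  by apply/measurable_EFinP; apply: measurable_funM; exact: L2_measurable.
have ff0 : (\int[pi]_x `|(f x * f x)%:E| = 0)%E.
  under eq_integral do rewrite abse_EFin ger0_norm ?sqr_ge0//.
  (* [dot] is the [fine] of an extended integral, and [fine] also sends infinite values to 0;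
     integrability excludes this case. *)
  have := integrable_fin_num measurableT (L2_mul_integrable f f).
  by move=> /fineK <-; move: ff; rewrite /dot /Rintegral => ->.
have {}ff0 := (ae_eq_integral_abs pi measurableT mff).1 ff0.
apply: filterS2 ff0 (L2_cstE 0) => x /(_ I) [] + + xT => /eqP.
by rewrite mulf_eq0 orbb => /eqP -> /(_ xT) ->.
Qed.

(** A single test vector suffices: with [h] the difference of [f] and [g], the equation says that
    [dot h h] vanishes. *)
Lemma eq_L2_dot f g h : h = L2_lin (-1) g f ->
  dot h f = dot h g -> f = g.
Proof.
move=> hE hfg; apply/L2P.
have /L2P h0 : h = L2_cst 0 by apply: dot_eq0; rewrite {2}hE dot_linr hfg mulN1r addNr.
have := L2_linE (-1) g f; rewrite -hE => hE'.
apply: filterS3 h0 (L2_cstE 0) hE' => x + + + xT.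
move=> /(_ xT) -> /(_ xT) -> /(_ xT) /esym/eqP.
by rewrite mulN1r addrC subr_eq0 => /eqP.
Qed.

Lemma mean0_lin a f g : mean0 pi f -> mean0 pi g -> mean0 pi (L2_lin a f g).
Proof. by rewrite !mean0P dot_linl => -> ->; rewrite mulr0 addr0. Qed.

Lemma mean0_scale a f : mean0 pi f -> mean0 pi (L2_scale a f).
Proof. by rewrite !mean0P dot_scalel => ->; rewrite mulr0. Qed.

Lemma norm2_0 : norm2 pi (fun=> 0) = 0%E.
Proof.
rewrite /norm2 (_ : _ \o _ = cst 0%E); last by apply/funext.
by rewrite Lnorm0.
Qed.

Lemma norm2Z a u : measurable_fun [set: S] u ->
  norm2 pi (fun x => a * u x) = (`|a|%:E * norm2 pi u)%E.
Proof.
move=> mu; rewrite /norm2 unlock /Lnorm.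
under eq_integral do rewrite /= normrM powRM// EFinM.
rewrite ge0_integralZl_EFin ?powR_ge0//; last first.
  apply/measurable_EFinP/(@measurableT_comp _ _ _ _ _ _ (@powR R ^~ 2)) => //.
  exact: measurableT_comp.
rewrite poweRM ?integral_ge0//.
by rewrite poweR_EFin -powRrM mulfV// powRr1.
Qed.

Lemma ae_eq_norm2 u v : measurable_fun [set: S] u -> measurable_fun [set: S] v ->
  u = v %[ae pi] -> norm2 pi u = norm2 pi v.
Proof.
move=> mu mv uv; rewrite /norm2 unlock /Lnorm; congr (_ `^ _)%E.
have mN (w : S -> R) : measurable_fun [set: S] w ->
    measurable_fun [set: S] (fun x => `|(w x)%:E| `^ 2)%E.
  move=> mw; apply: (@measurableT_comp _ _ _ _ _ _ (@poweR R ^~ 2)).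
    exact: measurable_poweR.
  by apply: measurableT_comp => //; exact/measurable_EFinP.
apply: ae_eq_integral => //; [exact: mN|exact: mN|].
by apply: filterS uv => x uvx xT /=; rewrite uvx.
Qed.

Lemma dense_in_self (H : set (L2 pi)) : dense_in H H.
Proof.
split=> // f e Hf e0; exists f => //.
rewrite (_ : (fun x => f x - f x) = (fun=> 0)) ?norm2_0 ?lte_fin//.
by apply/funext => x; rewrite subrr.
Qed.

(** With domain all of [H], the adjoint can only have the same domain, so the one thing to prove is
    [A g = h]. The test vector is [A g - h], which [Hlin] keeps in [H]. *)
Lemma symmetric_self_adjoint (H : set (L2 pi)) (A : L2 pi -> L2 pi) :
  (forall a f g, H f -> H g -> H (L2_lin a f g)) ->
  (forall f, H f -> H (A f)) ->
  (forall f g, H f -> H g -> dot (A f) g = dot f (A g)) ->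
  self_adjoint H H A.
Proof.
move=> Hlin HA symA; split; first exact: dense_in_self.
  by move=> _ [f Hf <-]; exact: HA.
move=> g h Hg Hh; split=> [Agh|[_ <-] f Hf]; last exact: symA.
have Hk : H (L2_lin (-1) h (A g)) by apply: Hlin => //; exact: HA.
split=> //; apply: eq_L2_dot erefl _.
by rewrite -symA// Agh.
Qed.

End L2_theory.

(** * Inverting a self-adjoint operator whose range is the mean zero functions *)

Section generalized_inverse.
Context d (S : measurableType d) (R : realType) (pi : probability S R).
Context (D : set (L2 pi)) (A : L2 pi -> L2 pi).
Hypotheses (saA : self_adjoint [set: L2 pi] D A) (rangeA : A @` D = mean0 pi).

(** This is the adjoint equivalence at the pair [(g, A g)], read from right to left. *)
Lemma self_adjoint_symmetric f g : D f -> D g -> dot (A f) g = dot f (A g).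
Proof. by case: saA => _ _ /(_ g (A g) I I) [_ h] Df Dg; apply: h. Qed.

(* The constants are orthogonal to the range of [A], hence in the kernel of its
   adjoint [A]. *)
Lemma self_adjoint_center v : D v ->
  exists w, [/\ D w, mean0 pi w & A w = A v].
Proof.
move=> Dv; pose w := L2_lin (- dot v (L2_cst pi 1)) (L2_cst pi 1) v.
have [Dw Aw] : D w /\ A w = A v.
  (* Testing [w] against [A f] for every [f] in [D] yields both [D w] and [A w = A v]: the constant
     part of [w] disappears because [A f] has mean zero. *)
  case: saA => _ _ /(_ w (A v) I I) [+ _]; apply => f Df.
  have : mean0 pi (A f) by rewrite -rangeA; exists f.
  rewrite mean0P /w dot_linr => ->; rewrite mulr0 add0r.
  exact: self_adjoint_symmetric.
exists w; split => //.
by rewrite mean0P /w dot_linl dot_cst_cst mulr1 addNr.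
Qed.

(** [xget] returns some [u] with [f = A u + k] and [k] orthogonal to the range. Here [k] is a
    difference of mean zero functions, hence also in the range, so it is orthogonal to itself and
    vanishes. *)
Lemma generalized_inverseP f : mean0 pi f ->
  [/\ D (generalized_inverse D A f), mean0 pi (generalized_inverse D A f) &
      A (generalized_inverse D A f) = f].
Proof.
move=> f0.
have [Du u0 [k [kA fE]]] : [set u | [/\ D u, mean0 pi u &
    exists k, (forall g, D g -> dot (A g) k = 0) /\
              f = (fun x => A u x + k x) %[ae pi]]] (generalized_inverse D A f).
  (* The set is inhabited: a preimage of [f], once centered, works with [k = 0]. *)
  apply: xgetPex.
  have [v Dv fE] : (A @` D) f by rewrite rangeA.
  have [w [Dw w0 AwE]] := self_adjoint_center Dv.
  exists w; split=> //; exists (L2_cst pi 0); split=> [g Dg|].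
    by rewrite dot_cstr mul0r.
  apply: filterS (L2_cstE pi 0) => x + xT => /(_ xT) ->.
  by rewrite AwE fE addr0.
have {}fE : f = L2_lin 1 (A (generalized_inverse D A f)) k.
  apply/L2P; apply: filterS2 fE (L2_linE 1 (A (generalized_inverse D A f)) k).
  by move=> x + + xT => /(_ xT) -> /(_ xT) ->; rewrite mul1r.
have Au0 : mean0 pi (A (generalized_inverse D A f)).
  by rewrite -rangeA; exists (generalized_inverse D A f).
have k0 : mean0 pi k.
  move: f0 Au0; rewrite !mean0P {1}fE dot_linl => + Au0.
  by rewrite Au0 mulr0 add0r.
have [w Dw kE] : (A @` D) k by rewrite rangeA.
have {}k0 : k = L2_cst pi 0 by apply: dot_eq0; rewrite -{1}kE kA.
split=> //; rewrite [RHS]fE; apply/L2P.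
apply: filterS2 (L2_linE 1 (A (generalized_inverse D A f)) k) (L2_cstE pi 0).
by move=> x + + xT => /(_ xT) -> /(_ xT); rewrite mul1r k0 => ->; rewrite addr0.
Qed.

(** With [A u = f] and [A v = g], both sides are values of the symmetric form of [A] at [u] and
    [v]. *)
Lemma generalized_inverse_symmetric f g : mean0 pi f -> mean0 pi g ->
  dot (generalized_inverse D A f) g = dot f (generalized_inverse D A g).
Proof.
move=> /generalized_inverseP[Du _ Au] /generalized_inverseP[Dv _ Av].
by rewrite -[in LHS]Av -self_adjoint_symmetric// Au.
Qed.

End generalized_inverse.

(** * Running a Markov process and its semigroup at speed [c] *)

Section time_change.
Context d (S : measurableType d) (R : realType) (pi : probability S R).
Context (K : R -> R.-pker S ~> S) (c : R).
Hypothesis c_gt0 : 0 < c.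

(** Measurability in the starting point holds for kernel integrals of nonnegative functions, hence
    the split into positive and negative parts. *)
Lemma semigroup_measurable (t : R) (f : L2 pi) :
  measurable_fun [set: S] (semigroup K t f).
Proof.
apply: (@measurableT_comp _ _ _ _ _ _ (@fine R)) => //.
under [X in measurable_fun _ X]eq_fun do rewrite integralE.
have mf := (measurable_EFinP _ _).2 (L2_measurable f).
apply: emeasurable_funB.
- apply: measurable_fun_integral_kernel => //; last exact: measurable_funepos.
  by move=> U mU; exact: measurable_kernel.
- apply: measurable_fun_integral_kernel => //; last exact: measurable_funeneg.
  by move=> U mU; exact: measurable_kernel.
Qed.

Lemma cvg_at_right0Z : c * t @[t --> 0^'+] --> 0^'+.
Proof.
move=> P [e /= e0 eP]; exists (e / c) => /=; first by rewrite divr_gt0.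
move=> t /= te t0; apply: eP; last by rewrite mulr_gt0.
move: te; rewrite /= !sub0r !normrN normrM (gtr0_norm c_gt0).
by rewrite ltr_pdivlMr// mulrC.
Qed.

Lemma time_change_strongly_continuous (H : set (L2 pi)) :
  strongly_continuous K H -> strongly_continuous (fun t => K (c * t)) H.
Proof. by move=> sc f Hf; apply: (cvg_comp _ _ cvg_at_right0Z (sc f Hf)). Qed.

(** Chain rule at 0: the error of the new difference quotient at [t] is [c] times the error of the
    old one at [c * t]. *)
Lemma time_change_derivative0 (f h g : L2 pi) :
  g = (fun x => c * h x) %[ae pi] ->
  derivative0 K f h -> derivative0 (fun t => K (c * t)) f g.
Proof.
move=> gE dfh.
have /(cvgeZl (y := c%:E) isT) := cvg_comp _ _ cvg_at_right0Z dfh.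
rewrite mule0; apply: cvg_trans; apply: near_eq_cvg.
near=> t.
have t_gt0 : 0 < t by near: t; exact: nbhs_right_gt.
have mu : measurable_fun [set: S] (fun x => semigroup K (c * t) f x - f x).
  by apply: measurable_funB; [exact: semigroup_measurable|exact: L2_measurable].
have mv : measurable_fun [set: S]
    (fun x => (c * t)^-1 * (semigroup K (c * t) f x - f x) - h x).
  by apply: measurable_funB; [exact: measurable_funM|exact: L2_measurable].
(* Writing the factor [c] as its absolute value lets [norm2Z] move it inside the norm. *)
rewrite /= -{1}(gtr0_norm c_gt0) -norm2Z//.
apply: ae_eq_norm2.
- exact: measurable_funM.
- by apply: measurable_funB; [exact: measurable_funM|exact: L2_measurable].
apply: filterS gE => x + xT => /(_ xT) ->.
by rewrite mulrBr mulrA invfM mulrA divff ?gt_eqF// mul1r.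
Unshelve. all: by end_near. Qed.

(** As the domain is all of [H], maximality of the domain reduces to every [f] in [H] having a
    derivative in [H], namely [c] times the old one. *)
Lemma time_change_generator (H : set (L2 pi)) (A : L2 pi -> L2 pi) :
  (forall f, H f -> H (L2_scale c f)) -> generator K H H A ->
  generator (fun t => K (c * t)) H H (fun f => L2_scale c (A f)).
Proof.
move=> HZ [sc _ dA].
have dcA f : H f -> H (L2_scale c (A f)) /\
    derivative0 (fun t => K (c * t)) f (L2_scale c (A f)).
  move=> /dA[HAf dAf]; split; first exact: HZ.
  exact: time_change_derivative0 (L2_scaleE c (A f)) dAf.
split=> //; first exact: time_change_strongly_continuous.
apply/seteqP; split=> [f Hf|f []//]; split=> //.
by have [HAf dAf] := dcA f Hf; exists (L2_scale c (A f)).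
Qed.

(** Multiplication by [c] fixes 0, is additive and preserves order, so each axiom is the original
    one at dilated times; the filtration is dilated along with the process. *)
Lemma time_change_markov_process dW (W : measurableType dW) (P : probability W R)
    (F : R -> set (set W)) (X : R -> W -> S) :
  markov_process P F pi K X ->
  markov_process P (fun t => F (c * t)) pi (fun t => K (c * t)) (fun t => X (c * t)).
Proof.
have cge0 t : 0 <= t -> 0 <= c * t by move=> ?; rewrite mulr_ge0// ltW.
move=> [[Fsigma Fincr] Xad [K0 KD] [invK X0 markovX]]; split.
- split=> [t /cge0|s t s0 st]; first exact: Fsigma.
  by apply: Fincr; [exact: cge0|rewrite ler_pM2l].
- by move=> t B /cge0 ct mB; exact: Xad.
- split=> [x B mB|s t x B /cge0 cs /cge0 ct mB]; first by rewrite mulr0 K0.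
  by rewrite mulrDr KD.
- split=> [t B /cge0 ct mB|B mB|s t B C /cge0 cs st mB FC]; first exact: invK.
    by rewrite mulr0 X0.
  by rewrite mulrBr (markovX (c * s))// ler_pM2l.
Qed.

End time_change.

Theorem theorem4p2 (R : realType)
    (d : measure_display) (S : measurableType d) (pi : probability S R)
    (dX : measure_display) (OmegaX : measurableType dX) (PX : probability OmegaX R)
    (FX : R -> set (set OmegaX)) (X : R -> OmegaX -> S) (KX : R -> R.-pker S ~> S)
    (D : set (L2 pi)) (A : L2 pi -> L2 pi)
    (dB : measure_display) (OmegaB : measurableType dB) (PB : probability OmegaB R)
    (B : L2 pi -> R -> {RV PB >-> R}) :
  measure_is_complete PX ->
  markov_process PX FX pi KX X ->
  progressively_measurable FX X ->
  ergodic pi KX ->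
  generator KX [set: L2 pi] D A ->
  self_adjoint [set: L2 pi] D A ->
  A @` D = mean0 pi ->
  bounded_linear_on (mean0 pi) (generalized_inverse D A) ->
  (exists (dZ : measure_display) (OmegaZ : measurableType dZ)
     (PZ : probability OmegaZ R) (FZ : R -> set (set OmegaZ))
     (Z : R -> OmegaZ -> S) (KZ : R -> R.-pker S ~> S),
     markov_process PZ FZ pi KZ Z /\
     generator KZ (mean0 pi) (A @` D) (generalized_inverse D A)) ->
  brownian_field (fun f g => - 2 * dot f (generalized_inverse D A g)) B ->
  exists (dY : measure_display) (OmegaY : measurableType dY)
    (PY : probability OmegaY R) (FY : R -> set (set OmegaY))
    (Y : R -> OmegaY -> S) (KY : R -> R.-pker S ~> S),
    [/\ markov_process PY FY pi KY Y,
        is_dirichlet_form KY (mean0 pi)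
          (fun f g => - 2 * dot f (generalized_inverse D A g)),
        associated (fun f => B f 1) KY &
        forall f g, mean0 pi f -> mean0 pi g ->
          'E_PB[fun w => (B f 1 w * B g 1 w)%R]%E =
          (- 2 * dot f (generalized_inverse D A g))%:E].
Proof.
move=> _ _ _ _ _ saA rangeA _ [dZ [WZ [PZ [FZ [Z [KZ [mZ genZ]]]]]]] [gB _ _ covB].
(* The domain of the inverse becomes the whole space [mean0 pi], the form that
   [time_change_generator] requires. *)
rewrite rangeA in genZ.
set V := fun f g => - 2 * dot f (generalized_inverse D A g).
have dirV : is_dirichlet_form (fun t => KZ (2 * t)) (mean0 pi) V.
  exists (fun f => L2_scale 2 (generalized_inverse D A f)); split.
  - by apply: time_change_generator => // f; exact: mean0_scale.
  - apply: symmetric_self_adjoint => [a f g|f f0|f g f0 g0].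
    + exact: mean0_lin.
    + by apply: mean0_scale; case: (generalized_inverseP saA rangeA f0).
    + rewrite dot_scalel dot_scaler.
      by rewrite (generalized_inverse_symmetric saA rangeA).
  - by move=> f g _ _; rewrite /dirichlet_form dot_scaler -mulNr.
have covV f g : mean0 pi f -> mean0 pi g ->
    'E_PB[fun w => (B f 1 w * B g 1 w)%R]%E = (V f g)%:E.
  by move=> f0 g0; rewrite covB// minxx mul1r.
exists dZ, WZ, PZ, (fun t => FZ (2 * t)), (fun t => Z (2 * t)), (fun t => KZ (2 * t)).
split=> //; first exact: time_change_markov_process.
split; last by exists V.
(* Joint Gaussianity of the time 1 slice comes from the space-time field at the indices
   [(i k, 1)]. *)
move=> n a i i0; apply: (gB n a (fun k => (i k, 1))) => k.
by split; [exact: i0|exact: ler01].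
Qed.
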